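(* Let $N\in\mathbb{N}$, let $A$ be a semi-infinite Jacobi matrix with off-diagonal entries $a_1,a_2,\ldots>0$ and diagonal entries $b_1,b_2,\ldots\in\mathbb{R}$, and let $A^N$ be its upper-left $N\times N$ block, with eigenvalues $\lambda_1,\ldots,\lambda_N$. Let $\phi^k=(\phi_1(\lambda_k),\ldots,\phi_N(\lambda_k))\in\mathbb{R}^N$, and let $f_k\in\mathcal{F}^N$ be the unique control with $W^Nf_k=\phi^k$, $k=1,\ldots,N$. Then the spectrum of $A^N$ and the (non-normalized) controls $f_k$, $k=1,\ldots,N$, are the spectrum and the eigenvectors of the generalized spectral problem $$\left(P\left(D^{N+1}_-\right)^*C^{N+1}P^*+C^ND^N_-\right)f_k=\lambda_kC^Nf_k,\qquad k=1,\ldots,N.$$ That is, each pair $(\lambda_k,f_k)$ satisfies this equation, and conversely, if $\lambda$ and $f\in\mathcal{F}^N\setminus\{0\}$ satisfy $\left(P(D^{N+1}_-)^*C^{N+1}P^*+C^ND^N_-\right)f=\lambda C^Nf$, then for some $k$ one has $\lambda=\lambda_k$ and $f$ is a scalar multiple of $f_k$.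
   Context: Set $a_0=1$. The polynomials $\phi_n(\lambda)$ are defined by $\phi_0=0$, $\phi_1=1$, $a_n\phi_{n+1}+a_{n-1}\phi_{n-1}+b_n\phi_n=\lambda\phi_n$ for $n\ge 1$. The roots of $\phi_{N+1}$ are $\lambda_1,\ldots,\lambda_N$; they are real and distinct and are the eigenvalues of $A^N$. For $T\in\mathbb{N}$ let $\mathcal{F}^T=\mathbb{R}^T$ with elements (controls) $f=(f_0,\ldots,f_{T-1})$, and $\mathcal{H}^T=\mathbb{R}^T$ with elements $h=(h_1,\ldots,h_T)$. For a control $f$ (a real sequence; elements of $\mathcal{F}^T$ are extended by zero), $u^f_{n,t}$ is the solution of $$u_{n,t+1}+u_{n,t-1}-a_nu_{n+1,t}-a_{n-1}u_{n-1,t}-b_nu_{n,t}=0\ (n\ge1,\ t\ge0),\quad u_{n,-1}=u_{n,0}=0\ (n\ge1),\quad u_{0,t}=f_t\ (t\ge0).$$ The control operator $W^T:\mathcal{F}^T\to\mathcal{H}^T$ is $(W^Tf)_n=u^f_{n,T}$, $n=1,\ldots,T$; it is an isomorphism. The connecting operator is $C^T=(W^T)^*W^T$ on $\mathcal{F}^T$ (a $T\times T$ matrix). $D^N_-:\mathcal{F}^N\to\mathcal{F}^N$ is the shift $(D^N_-f)_0=0$, $(D^N_-f)_n=f_{n-1}$ for $n=1,\ldots,N-1$. $P:\mathcal{F}^{N+1}\to\mathcal{F}^N$ drops the last coordinate: $(Pf)_k=f_k$, $k=0,\ldots,N-1$; its adjoint $P^*:\mathcal{F}^N\to\mathcal{F}^{N+1}$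 appends a zero as last coordinate. *)

(* Defs.v *)
From HB Require Import structures.
From mathcomp Require Import all_boot all_order all_algebra.
From mathcomp Require Import reals ring.

Set Implicit Arguments.
Unset Strict Implicit.
Unset Printing Implicit Defensive.

Import Order.TTheory GRing.Theory Num.Theory.
Local Open Scope ring_scope.

(* The Jacobi parameters are sequences a, b : nat -> R carrying
   the usual indices: a n for n >= 0 (with a 0 = 1 assumed where needed) and
   b n for n >= 1 (b 0 is never used). *)

Definition jacobi_entry (R : realType) (a b : nat -> R) (m n : nat) : R :=
  if m == n then b n
  else if n == m.+1 then a m
  else if m == n.+1 then a n
  else 0.

(* The ordinal i : 'I_N stands for the index i + 1 of 1, ..., N. *)
Definition jacobi_block (R : realType) (a b : nat -> R) (N : nat) : 'M[R]_N :=
  \matrix_(i < N, j < N) jacobi_entry a b i.+1 j.+1.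

Fixpoint phi (R : realType) (a b : nat -> R) (n : nat) : {poly R} :=
  match n with
  | 0 => 0
  | n'.+1 =>
      match n' with
      | 0 => 1
      | m.+1 => (a n')^-1 *: (('X - (b n')%:P) * phi a b n' - a m *: phi a b m)
      end
  end.

Lemma phi_rec (R : realType) (a b : nat -> R) (n : nat) : a n.+1 != 0 ->
  a n.+1 *: phi a b n.+2 + a n *: phi a b n + b n.+1 *: phi a b n.+1
    = 'X * phi a b n.+1.
Proof.
move=> an0; rewrite [phi a b n.+2]/= scalerA mulfV // scale1r.
by rewrite -/(phi a b n.+1) subrK mulrBl mul_polyC subrK.
Qed.

Definition phi_vec (R : realType) (a b : nat -> R) (N : nat) (l : R) : 'cV[R]_N :=
  \col_(i < N) (phi a b i.+1).[l].

Definition extend0 (R : realType) (T : nat) (f : 'cV[R]_T) (t : nat) : R :=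
  if insub t is Some i then f i 0 else 0.

(* wave a b f n t is u^f_{n,t} for n, t >= 0; the innermost 0 is u_{n,-1}. *)
Fixpoint wave (R : realType) (a b f : nat -> R) (n t : nat) {struct t} : R :=
  match n with
  | 0 => f t
  | m.+1 =>
      match t with
      | 0 => 0
      | s.+1 =>
          a n * wave a b f n.+1 s + a m * wave a b f m s + b n * wave a b f n s
          - (if s is r.+1 then wave a b f n r else 0)
      end
  end.

Lemma wave_boundary (R : realType) (a b f : nat -> R) (t : nat) :
  wave a b f 0 t = f t.
Proof. by case: t. Qed.

Lemma wave_initial (R : realType) (a b f : nat -> R) (n : nat) :
  wave a b f n.+1 0 = 0.
Proof. by []. Qed.

Lemma wave_eq (R : realType) (a b f : nat -> R) (n t : nat) :
  wave a b f n.+1 t.+1 + (if t is r.+1 then wave a b f n.+1 r else 0)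
  - a n.+1 * wave a b f n.+2 t - a n * wave a b f n t
  - b n.+1 * wave a b f n.+1 t = 0.
Proof.
rewrite [wave a b f n.+1 t.+1]/= subrK.
by rewrite -!addrA -!opprD !addrA subrr.
Qed.

(* Controls f_0, ..., f_{T-1} are indexed from 0, so i : 'I_T is the time i;
   states h_1, ..., h_T are indexed from 1, so i : 'I_T is the site i + 1. *)
Definition control_op (R : realType) (a b : nat -> R) (T : nat) (f : 'cV[R]_T) :
    'cV[R]_T :=
  \col_(i < T) wave a b (extend0 f) i.+1 T.

Definition shift_op (R : realType) (T : nat) (f : 'cV[R]_T) : 'cV[R]_T :=
  \col_(i < T) (if nat_of_ord i is j.+1 then extend0 f j else 0).

Definition drop_last (R : realType) (N : nat) (f : 'cV[R]_N.+1) : 'cV[R]_N :=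
  \col_(i < N) f (widen_ord (leqnSn N) i) 0.

(* The matrix of a linear map in the standard bases; its adjoint for the
   standard inner products is then the transpose. *)
Definition op_mx (R : realType) (m n : nat) (F : 'cV[R]_n -> 'cV[R]_m) :
    'M[R]_(m, n) :=
  \matrix_(i < m, j < n) F (delta_mx j 0) i 0.

Lemma op_mxE (R : realType) (m n : nat) (F : 'cV[R]_n -> 'cV[R]_m) :
  linear F -> forall f, op_mx F *m f = F f.
Proof.
move=> linF f.
have F0 : F 0 = 0.
  by have := linF 1 0 0; rewrite !scale1r addr0 -[LHS]addr0 => /addrI.
have -> : F f = \sum_j f j 0 *: F (delta_mx j 0).
  have {1}-> : f = \sum_j f j 0 *: delta_mx j 0.
    by rewrite {1}[f]matrix_sum_delta; apply: eq_bigr => j _; rewrite big_ord1.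
  elim: (index_enum _) => [|j s IH]; first by rewrite !big_nil.
  by rewrite !big_cons linF IH.
apply/matrixP => i k; rewrite !mxE summxE ord1.
by apply: eq_bigr => j _; rewrite !mxE mulrC.
Qed.

Lemma extend0_linear (R : realType) (T : nat) (c : R) (f g : 'cV[R]_T) (t : nat) :
  extend0 (c *: f + g) t = c * extend0 f t + extend0 g t.
Proof. by rewrite /extend0; case: insub => [i|]; rewrite ?mxE ?mulr0 ?addr0. Qed.

Lemma control_op_linear (R : realType) (a b : nat -> R) (T : nat) :
  linear (@control_op R a b T).
Proof.
move=> c f g; apply/colP => i; rewrite !mxE.
have W : forall t n, wave a b (extend0 (c *: f + g)) n t =
    c * wave a b (extend0 f) n t + wave a b (extend0 g) n t.
  elim/ltn_ind => t IH [|n]; first by rewrite !wave_boundary extend0_linear.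
  case: t IH => [|s] IH; first by rewrite /= mulr0 addr0.
  rewrite /= !IH //; case: s IH => [|r] IH; first by ring.
  by rewrite !IH ?ltnS ?leqnSn //; ring.
exact: W.
Qed.

Lemma shift_op_linear (R : realType) (T : nat) : linear (@shift_op R T).
Proof.
move=> c f g; apply/colP => i; rewrite !mxE.
by case: (nat_of_ord i) => [|j]; rewrite ?extend0_linear // mulr0 addr0.
Qed.

Lemma drop_last_linear (R : realType) (N : nat) : linear (@drop_last R N).
Proof. by move=> c f g; apply/colP => i; rewrite !mxE. Qed.

Definition control_mx (R : realType) (a b : nat -> R) (T : nat) : 'M[R]_T :=
  op_mx (@control_op R a b T).

Definition connecting_mx (R : realType) (a b : nat -> R) (T : nat) : 'M[R]_T :=
  (control_mx a b T)^T *m control_mx a b T.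

Definition shift_mx (R : realType) (T : nat) : 'M[R]_T := op_mx (@shift_op R T).

Definition drop_mx (R : realType) (N : nat) : 'M[R]_(N, N.+1) :=
  op_mx (@drop_last R N).

(* Main.v *)
(** Since [u] solves the wave equation, [u_{n,N+1} + u_{n,N-1}] is the [n]-th
    entry of [A^N (W^N f)]: the boundary term [a_0 f_N] vanishes because [f] is
    extended by zero, and [a_N u_{N+1,N}] vanishes by finite speed of
    propagation.  Delaying the control by one step delays the wave by one step,
    so the operator on the left-hand side of the generalized problem is
    [(W^N)^* A^N W^N].  As [W^N] is invertible, the problem is the eigenvalue
    problem of [A^N] conjugated by [W^N], and every eigenvector of a Jacobi
    matrix for [l] is a multiple of [(phi_1 l, ..., phi_N l)]. *)
Require Import Defs.
From HB Require Import structures.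
From mathcomp Require Import all_boot all_order all_algebra.
From mathcomp Require Import reals ring zify.

Import Order.TTheory GRing.Theory Num.Theory.
Local Open Scope ring_scope.

Lemma mulmx_cV_inj {R : pzSemiRingType} {m n : nat} (A B : 'M[R]_(m, n)) :
  (forall v : 'cV[R]_n, A *m v = B *m v) -> A = B.
Proof.
move=> AB; apply/matrixP => i j.
by have /colP/(_ i) := AB (delta_mx j 0); rewrite -!colE !mxE.
Qed.

(** * Waves: dependence on the control, delay and finite speed of propagation *)

Section Waves.
Context {R : realType}.
Variables (a b : nat -> R).

Lemma wave_step (F : nat -> R) (n t : nat) :
  wave a b F n.+1 t.+2 + wave a b F n.+1 t =
  a n.+1 * wave a b F n.+2 t.+1 + a n * wave a b F n t.+1
  + b n.+1 * wave a b F n.+1 t.+1.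
Proof. exact: subrK. Qed.

Lemma wave_step0 (F : nat -> R) (n : nat) :
  wave a b F n.+1 1 =
  a n.+1 * wave a b F n.+2 0 + a n * wave a b F n 0 + b n.+1 * wave a b F n.+1 0.
Proof. exact: subr0. Qed.

Lemma eq_wave (F G : nat -> R) (t : nat) :
  (forall s, (s <= t)%N -> F s = G s) ->
  forall n, wave a b F n t = wave a b G n t.
Proof.
elim/ltn_ind: t => t IH FG [|n]; first by rewrite !wave_boundary FG.
have IH' s : (s < t)%N -> forall m, wave a b F m s = wave a b G m s.
  move=> st; apply: IH => // r rs.
  by apply: FG; exact: leq_trans rs (ltnW st).
case: t IH' {IH FG} => [//|[|t]] IH'; first by rewrite !wave_step0 !IH'.
by apply: (addIr (wave a b F n.+1 t)); rewrite wave_step !IH' // -wave_step.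
Qed.

(** A boundary value at time [s] first acts on interior sites at time [s + 1], hence the strict
    bound. *)
Lemma eq_wave_interior (F G : nat -> R) (t : nat) :
  (forall s, (s < t)%N -> F s = G s) ->
  forall n, wave a b F n.+1 t = wave a b G n.+1 t.
Proof.
move=> FG n.
have FG' s : (s < t)%N -> forall m, wave a b F m s = wave a b G m s.
  by move=> st; apply: eq_wave => r rs; apply: FG; exact: leq_ltn_trans st.
case: t FG' {FG} => [//|[|t]] FG'; first by rewrite !wave_step0 !FG'.
by apply: (addIr (wave a b F n.+1 t)); rewrite wave_step !FG' // -wave_step.
Qed.

(** The coefficients do not depend on time, and the delayed control is silent at time 0, so its wave
    is still at rest when the original one starts. *)
Lemma wave_delay (F : nat -> R) (n t : nat) :
  wave a b (fun s => if s is r.+1 then F r else 0) n t.+1 = wave a b F n t.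
Proof.
elim/ltn_ind: t n => t IH [|n]; first by rewrite !wave_boundary.
have W0 m : wave a b (fun s => if s is r.+1 then F r else 0) m 0 = 0 by case: m.
case: t IH => [|t] IH; first by rewrite wave_step0 !W0 !mulr0 !addr0.
case: t IH => [|t] IH.
  apply: (addIr (wave a b (fun s => if s is r.+1 then F r else 0) n.+1 0)).
  by rewrite wave_step !IH // wave_step0 addr0.
apply: (addIr (wave a b F n.+1 t)); rewrite -[in LHS]IH; last by lia.
by rewrite wave_step !IH // wave_step.
Qed.

(** Finite speed of propagation: a disturbance moves at most one site per time step. *)
Lemma wave_front0 (F : nat -> R) (d : nat) :
  (forall s, (s < d)%N -> F s = 0) ->
  forall n t, (t < n + d)%N -> wave a b F n t = 0.
Proof.
move=> F0 n t; elim/ltn_ind: t n => t IH [|n] lt.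
  by rewrite wave_boundary F0.
case: t IH lt => [//|[|t]] IH lt.
  by rewrite wave_step0 !IH ?mulr0 ?addr0 //; lia.
apply: (addIr (wave a b F n.+1 t)); rewrite wave_step !IH ?mulr0 ?addr0 //; lia.
Qed.

(** On the front, every term of the wave equation except the one from the previous site lies ahead
    of the front and vanishes, so each step multiplies the amplitude by one off-diagonal entry. *)
Lemma wave_front (F : nat -> R) (d n : nat) :
  (forall s, (s < d)%N -> F s = 0) ->
  wave a b F n (n + d)%N = (\prod_(i < n) a i) * F d.
Proof.
move=> F0; elim: n => [|n IH]; first by rewrite wave_boundary big_ord0 mul1r.
rewrite big_ord_recr [X in _ = X * _]/= [_ * a n]mulrC -mulrA -IH addSn.
case E : (n + d)%N => [|t].
  by rewrite wave_step0 !(wave_front0 F d F0 _.+1 0) ?mulr0 ?addr0 ?add0r.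
apply: (addIr (wave a b F n.+1 t)); rewrite wave_step.
by rewrite !(wave_front0 F d F0 n.+1) ?(wave_front0 F d F0 n.+2)
  ?mulr0 ?addr0 ?add0r //; lia.
Qed.

End Waves.

(** * Extension by zero and the adjoint of the truncation *)

Lemma extend0_ord {R : realType} {T : nat} (f : 'cV[R]_T) (i : 'I_T) :
  extend0 f i = f i 0.
Proof. by rewrite /extend0 valK. Qed.

Lemma extend0_in {R : realType} {T : nat} (f : 'cV[R]_T) (t : nat)
  (tT : (t < T)%N) : extend0 f t = f (Ordinal tT) 0.
Proof. exact: extend0_ord f (Ordinal tT). Qed.

Lemma extend0_out {R : realType} {T : nat} (f : 'cV[R]_T) (t : nat) :
  (T <= t)%N -> extend0 f t = 0.
Proof. by move=> Tt; rewrite /extend0 insubN // -leqNgt. Qed.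

Lemma extend0_shift {R : realType} {T : nat} (f : 'cV[R]_T) (t : nat) :
  (t < T)%N ->
  extend0 (shift_op f) t = if t is s.+1 then extend0 f s else 0.
Proof. by move=> tT; rewrite extend0_in mxE. Qed.

Lemma drop_mxT_mul {R : realType} {N : nat} (f : 'cV[R]_N) :
  (drop_mx R N)^T *m f = \col_(i < N.+1) extend0 f i.
Proof.
apply/colP => i; rewrite !mxE.
under eq_bigr => j _ do rewrite !mxE eqxx andbT.
case: (ltnP i N) => iN.
  rewrite (bigD1 (Ordinal iN)) //= big1 => [|j /eqP ji].
    rewrite extend0_in addr0.
    by rewrite (_ : _ == i) ?mul1r //; apply/eqP/val_inj.
  rewrite (_ : _ == i = false) ?mul0r //; apply/eqP => E; apply: ji.
  by apply: val_inj; rewrite /= -E.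
rewrite extend0_out // big1 // => j _.
rewrite (_ : _ == i = false) ?mul0r //; apply/eqP => E.
by move: iN; rewrite -E /= leqNgt ltn_ord.
Qed.

Lemma extend0_drop_mxT {R : realType} {N : nat} (f : 'cV[R]_N) (t : nat) :
  extend0 ((drop_mx R N)^T *m f) t = extend0 f t.
Proof.
rewrite drop_mxT_mul; case: (ltnP t N.+1) => tN.
  by rewrite extend0_in mxE.
by rewrite !extend0_out // ltnW.
Qed.

(** * The control operator: invertibility and intertwining relations *)

Section Control.
Context {R : realType}.
Variables (a b : nat -> R) (N : nat).

Lemma control_mxE (T : nat) (f : 'cV[R]_T) :
  control_mx a b T *m f = control_op a b f.
Proof. exact/op_mxE/control_op_linear. Qed.

Lemma control_op_eq0 (f : 'cV[R]_N) : (forall n, a n != 0) ->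
  control_op a b f = 0 -> f = 0.
Proof.
move=> a0 Wf0.
suff f0 d : (d < N)%N -> extend0 f d = 0.
  by apply/colP => i; rewrite -extend0_ord f0 // mxE.
elim/ltn_ind: d => d IH dN.
have Fd s : (s < d)%N -> extend0 f s = 0.
  by move=> sd; apply: IH => //; exact: ltn_trans dN.
(* At time [N] the signal sent at time [d] has its front at site [N - d], stored at index
   [N - d.+1]; earlier controls vanish, so this entry is [extend0 f d] times a nonzero product. *)
have nN : (N - d.+1 < N)%N by lia.
have /colP/(_ (Ordinal nN)) := Wf0; rewrite !mxE /=.
have -> : wave a b (extend0 f) (N - d.+1).+1 N =
          wave a b (extend0 f) (N - d.+1).+1 ((N - d.+1).+1 + d)%N.
  by congr wave; lia.
rewrite wave_front // => /eqP; rewrite mulf_eq0 => /orP[/prodf_eq0[i _]|/eqP //].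
by rewrite (negPf (a0 i)).
Qed.

Lemma control_mx_unit : (forall n, a n != 0) -> control_mx a b N \in unitmx.
Proof.
move=> a0; rewrite -unitmx_tr unitmxE unitfE; apply/det0P => -[v v0 vW].
case/negP: v0; rewrite -trmx_eq0; apply/eqP/control_op_eq0 => //.
by rewrite -control_mxE -[control_mx _ _ _]trmxK -trmx_mul vW trmx0.
Qed.

(** Both sides send [f] to its wave at time [N] on sites 1 to [N + 1]: the delay absorbs the extra
    time step, and the last site is not yet reached. *)
Lemma control_mx_shift_drop :
  control_mx a b N.+1 *m shift_mx R N.+1 *m (drop_mx R N)^T =
  (drop_mx R N)^T *m control_mx a b N.
Proof.
apply: mulmx_cV_inj => f; rewrite -!mulmxA (op_mxE (@shift_op_linear _ _)).
rewrite !control_mxE [in RHS]drop_mxT_mul; apply/colP => i; rewrite !mxE.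
transitivity (wave a b (extend0 f) i.+1 N).
  rewrite -[RHS]wave_delay; apply: eq_wave_interior => s sN.
  by rewrite extend0_shift //; case: s sN => // s _; rewrite extend0_drop_mxT.
case: (ltnP i N) => iN.
  by rewrite extend0_in mxE.
by rewrite extend0_out // (wave_front0 _ _ _ 0) // addn0.
Qed.

(** Without its guards the right-hand side is the three-term expression common to the wave equation
    and the recurrence of [phi]; the guards cut off the sites [N + 1] and 0. *)
Lemma jacobi_block_mul (v : nat -> R) (i : 'I_N) :
  (jacobi_block a b N *m \col_(j < N) v j.+1) i 0 =
  (if (i.+1 < N)%N then a i.+1 * v i.+2 else 0)
  + (if (0 < i)%N then a i * v i else 0) + b i.+1 * v i.+1.
Proof.
rewrite mxE.
have -> : \sum_j jacobi_block a b N i j * (\col_(j < N) v j.+1) j 0 =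
  \sum_(j < N) ((if j == i.+1 :> nat then a i.+1 * v i.+2 else 0)
    + (if (0 < i)%N && (j == i.-1 :> nat) then a i * v i else 0)
    + (if j == i :> nat then b i.+1 * v i.+1 else 0)).
  apply: eq_bigr => j _; rewrite !mxE /jacobi_entry !eqSS.
  case: (ltngtP i j) => ij.
  - rewrite (_ : (0 < i)%N && (j == i.-1 :> nat) = false); last by lia.
    rewrite (_ : (i == j.+1 :> nat) = false) ?addr0; last by lia.
    by case: eqP => [->|]; rewrite ?mul0r.
  - rewrite (_ : (0 < i)%N && (j == i.-1 :> nat) = (i == j.+1 :> nat)); last by lia.
    rewrite (_ : (j == i.+1 :> nat) = false) ?addr0 ?add0r; last by lia.
    by case: eqP => [->|]; rewrite ?mul0r.
  - rewrite (_ : (0 < i)%N && (j == i.-1 :> nat) = false); last by lia.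
    by rewrite ij (_ : (j == j.+1 :> nat) = false) ?add0r //; lia.
rewrite !big_split /= -!big_mkcond /=.
congr (_ + _ + _).
- case: ltnP => iN; first by rewrite (big_pred1 (Ordinal iN)).
  by rewrite big1 // => j /eqP E; have := ltn_ord j; lia.
- case: posnP => i0 /=; first by rewrite big_pred0.
  have iN : (i.-1 < N)%N by have := ltn_ord i; lia.
  by rewrite (big_pred1 (Ordinal iN)).
- by rewrite (big_pred1 i).
Qed.

(** The summands on the left give the states at times [N + 1] and [N - 1], so this is the wave
    equation at time [N]. *)
Lemma control_mx_wave_eq :
  drop_mx R N *m control_mx a b N.+1 *m (drop_mx R N)^T
    + control_mx a b N *m shift_mx R N =
  jacobi_block a b N *m control_mx a b N.
Proof.
apply: mulmx_cV_inj => f; rewrite mulmxDl -!mulmxA.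
rewrite (op_mxE (@shift_op_linear _ _)) (op_mxE (@drop_last_linear _ _)).
rewrite !control_mxE; apply/colP => i.
rewrite (jacobi_block_mul (fun n => wave a b (extend0 f) n N)) !mxE.
rewrite -[nat_of_ord (widen_ord _ _)]/(nat_of_ord i).
rewrite (eq_wave a b _ (extend0 f)); last by move=> s _; exact: extend0_drop_mxT.
have N0 : (0 < N)%N by exact: leq_ltn_trans (ltn_ord i).
have [M NM] : exists M, N = M.+1 by exists N.-1; rewrite prednK.
(* The shift loses the last coordinate of [f], which the delayed control would apply at time [N],
   too late to affect an interior site at that time. *)
have -> : wave a b (extend0 (shift_op f)) i.+1 N = wave a b (extend0 f) i.+1 M.
  rewrite -[RHS]wave_delay -NM; apply: eq_wave_interior => s sN.
  exact: extend0_shift.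
have step F n : wave a b F n.+1 N.+1 + wave a b F n.+1 M = a n.+1 * wave a b F n.+2 N
    + a n * wave a b F n N + b n.+1 * wave a b F n.+1 N.
  by rewrite NM wave_step.
rewrite step; congr (_ + _ + _).
- case: ltnP => // iN.
  by rewrite (wave_front0 _ _ _ 0) ?mulr0 // addn0.
- by case: posnP => // ->; rewrite wave_boundary extend0_out ?mulr0.
Qed.

Lemma generalized_mxE :
  drop_mx R N *m (shift_mx R N.+1)^T *m connecting_mx a b N.+1 *m (drop_mx R N)^T
    + connecting_mx a b N *m shift_mx R N =
  (control_mx a b N)^T *m jacobi_block a b N *m control_mx a b N.
Proof.
rewrite -[RHS]mulmxA -control_mx_wave_eq mulmxDr; congr (_ + _); last first.
  by rewrite /connecting_mx mulmxA.
(* The adjoint relation turns $P (D^{N+1}_-)^* (W^{N+1})^*$ into $(W^N)^* P$, so $(W^N)^*$ factors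
   out on the left. *)
have /(congr1 trmx) := control_mx_shift_drop.
rewrite !trmx_mul trmxK => E.
by rewrite /connecting_mx !mulmxA -[drop_mx R N *m _ *m _]mulmxA E.
Qed.

(** * Reduction to the eigenvectors of the Jacobi block *)

Lemma generalized_eigenE (l : R) (g : 'cV[R]_N) : (forall n, a n != 0) ->
  (drop_mx R N *m (shift_mx R N.+1)^T *m connecting_mx a b N.+1
      *m (drop_mx R N)^T
    + connecting_mx a b N *m shift_mx R N) *m g = l *: (connecting_mx a b N *m g)
  <-> jacobi_block a b N *m control_op a b g = l *: control_op a b g.
Proof.
move=> a0; rewrite generalized_mxE /connecting_mx -!mulmxA !control_mxE scalemxAr.
split=> [|-> //]; apply: (can_inj (mulKmx _)).
by rewrite unitmx_tr control_mx_unit.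
Qed.

(** Rows 1 to [N - 1] of the eigenvalue equation are the recurrence of [phi], so the first component
    of [v] determines all the others. *)
Lemma jacobi_eigenvector (l : R) (v : 'cV[R]_N) : (forall n, a n != 0) ->
  jacobi_block a b N *m v = l *: v -> v = extend0 v 0 *: phi_vec a b N l.
Proof.
move=> a0 Av; set c := extend0 v 0.
(* Indexing by sites with [w 0 = 0], like $\phi_0 = 0$, makes the first row an instance of the
   recurrence. *)
pose w n := if n is m.+1 then extend0 v m else 0.
have vw : v = \col_(i < N) w i.+1 by apply/colP => i; rewrite mxE /= extend0_ord.
suff W n : (n < N)%N -> w n = c * (phi a b n).[l] /\ w n.+1 = c * (phi a b n.+1).[l].
  apply/colP => i; rewrite {1}vw !mxE.
  by have [] := W i (ltn_ord i).
elim: n => [|n IH] nN; first by rewrite /= horner0 hornerC mulr0 mulr1.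
have [w0 w1] := IH (ltnW nN); split=> //.
have := congr1 (fun u : 'cV_N => u (Ordinal (ltnW nN)) 0) Av.
rewrite {1}vw jacobi_block_mul mxE -extend0_ord -[nat_of_ord _]/n nN.
have -> : (if (0 < n)%N then a n * w n else 0) = a n * w n.
  by case: n {IH nN w0 w1} => //=; rewrite mulr0.
rewrite -/(w n.+1) -/(w n.+2) w0 w1; have := phi_rec b (a0 n.+1).
move: (phi a b n) (phi a b n.+1) (phi a b n.+2) => p q r.
move=> /(congr1 (fun u => u.[l])); rewrite !hornerD !hornerZ hornerM hornerX => P E.
apply: (mulfI (a0 n.+1)); apply: (addIr (a n * (c * p.[l]))).
apply: (addIr (b n.+1 * (c * q.[l]))); rewrite E.
transitivity (c * (l * q.[l])); first by ring.
by rewrite -P; ring.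
Qed.

Lemma jacobi_block_sym : (jacobi_block a b N)^T = jacobi_block a b N.
Proof.
apply/matrixP => i j; rewrite !mxE /jacobi_entry !eqSS eq_sym.
case: eqP => [->//|_].
by case: (eqVneq (nat_of_ord i) j.+1) (eqVneq (nat_of_ord j) i.+1) => [E|_] [F|_] //; lia.
Qed.

(** [eigenvalue] concerns row vectors; symmetry of the block carries it over to columns. *)
Lemma jacobi_eigenvalueP (l : R) :
  reflect (exists2 v : 'cV[R]_N, jacobi_block a b N *m v = l *: v & v != 0)
    (eigenvalue (jacobi_block a b N) l).
Proof.
apply: (iffP eigenvalueP) => -[v Av v0]; exists v^T; rewrite ?trmx_eq0 //.
  by rewrite -jacobi_block_sym -trmx_mul Av linearZ.
by rewrite -jacobi_block_sym -trmx_mul Av linearZ.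
Qed.

End Control.

Theorem theorem3 (R : realType) (N : nat) (hN : (0 < N)%N)
  (a b : nat -> R) (ha0 : a 0%N = 1) (ha : forall n : nat, (0 < n)%N -> 0 < a n)
  (lam : 'I_N -> R) (lam_inj : injective lam)
  (lam_spec : forall x : R,
     eigenvalue (jacobi_block a b N) x <-> exists k : 'I_N, x = lam k)
  (f : 'I_N -> 'cV[R]_N)
  (hf : forall k : 'I_N, control_op a b (f k) = phi_vec a b N (lam k)) :
  (forall k : 'I_N,
     f k != 0 /\
     (drop_mx R N *m (shift_mx R N.+1)^T *m connecting_mx a b N.+1
        *m (drop_mx R N)^T
      + connecting_mx a b N *m shift_mx R N) *m f k
     = lam k *: (connecting_mx a b N *m f k)) /\
  (forall (l : R) (g : 'cV[R]_N), g != 0 ->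
     (drop_mx R N *m (shift_mx R N.+1)^T *m connecting_mx a b N.+1
        *m (drop_mx R N)^T
      + connecting_mx a b N *m shift_mx R N) *m g
     = l *: (connecting_mx a b N *m g) ->
     exists (k : 'I_N) (c : R), l = lam k /\ g = c *: f k).
Proof.
have a0 n : a n != 0.
  by case: n => [|n]; rewrite ?ha0 ?oner_neq0 // gt_eqF // ha.
have phiP l v : v != 0 -> jacobi_block a b N *m v = l *: v ->
    extend0 v 0 != 0 /\ v = extend0 v 0 *: phi_vec a b N l.
  move=> v0 /(jacobi_eigenvector a b N l v a0) E; split=> //.
  by apply: contraNneq v0 => c0; rewrite E c0 scale0r.
split=> [k|l g g0 /(generalized_eigenE a b N l g a0) Ag].
(* Some eigenvector [v] for [lam k] exists and is a nonzero multiple of $\phi^k$, so $\phi^k$ is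
   itself an eigenvector. *)
- have /jacobi_eigenvalueP[v Av v0] : eigenvalue (jacobi_block a b N) (lam k).
    by apply/lam_spec; exists k.
  have [c0 E] := phiP _ _ v0 Av; split.
    apply: contraNneq v0 => fk0.
    by rewrite E -hf -control_mxE fk0 mulmx0 scaler0.
  apply/generalized_eigenE => //; rewrite hf.
  apply: (scalerI c0); rewrite scalemxAr -E Av [in LHS]E.
  by rewrite !scalerA mulrC.
- have Wg0 : control_op a b g != 0.
    by apply: contraNneq g0 => /control_op_eq0 ->.
  have [k lk] : exists k, l = lam k.
    by apply/lam_spec/jacobi_eigenvalueP; exists (control_op a b g).
  have [_ E] := phiP _ _ Wg0 Ag.
  exists k, (extend0 (control_op a b g) 0); split=> //.
  apply: (can_inj (mulKmx (control_mx_unit a b N a0))).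
  by rewrite -scalemxAr !control_mxE hf -lk.
Qed.
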